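(* Let $0\le k<1$ and $K=\frac{1+k}{1-k}$. Let $h,g$ be the analytic functions on the open unit disk $\mathbb{D}$ with $h(0)=g(0)=0$ determined by $$h(z)-g(z)=\frac{z}{(1-z)^2},\qquad \frac{g'(z)}{h'(z)}=kz .$$ Then $f_k:=h+\overline g$ is a harmonic $K$-quasiconformal mapping, namely $f_k\in\mathcal{S}^0_{\mathcal H}(K)$, and it is given explicitly by $$f_k(z)=\frac{1}{(k-1)^3}\left[\frac{(k-1)(1-3k+2kz)z}{(1-z)^2}+k(k+1)\log\left(\frac{1-z}{1-kz}\right)\right]+\frac{k}{(k-1)^3}\overline{\left[\frac{(1-k)(1+k-2z)z}{(1-z)^2}+(k+1)\log\left(\frac{1-z}{1-kz}\right)\right]},$$ with power series $$f_k(z)=z+\sum_{n=2}^\infty A(n,k)z^n+\sum_{n=2}^\infty B(n,k)\overline{z}^n\qquad(z\in\mathbb{D}),$$ where $$A(n,k)=\frac{(1-k)^2n^2-2k(1-k)n+k(1+k)(1-k^n)}{(1-k)^3\,n},\qquad B(n,k)=\frac{k(1-k)^2n^2-2k(1-k)n+k(1+k)(1-k^n)}{(1-k)^3\,n}.$$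
   Context: $\mathbb{D}$ is the open unit disk in $\mathbb{C}$. $\mathcal{S}_{\mathcal H}$ is the class of complex-valued harmonic functions $f=h+\overline{g}$ on $\mathbb{D}$ ($h,g$ analytic) of the form $f(z)=z+\sum_{n\ge2}a_nz^n+\overline{\sum_{n\ge1}b_nz^n}$ that are univalent and sense-preserving in $\mathbb{D}$. For $K\ge1$, $\mathcal{S}_{\mathcal H}(K)$ is the class of $f\in\mathcal{S}_{\mathcal H}$ whose dilatation $\omega=g'/h'$ satisfies $|\omega|\le\frac{K-1}{K+1}$ on $\mathbb{D}$, and $\mathcal{S}^0_{\mathcal H}(K)$ is the subclass with $f_{\overline z}(0)=0$ (i.e. $b_1=0$). The logarithm is the branch on $\mathbb{D}$ of $\log\frac{1-z}{1-kz}$ vanishing at $z=0$. *)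

(* Defs.v *)
(* Stdlib reals with Coquelicot's complex numbers. *)
From Stdlib Require Import Reals.
From Coquelicot Require Import Coquelicot.
Open Scope C_scope.

Definition disk (z : C) : Prop := (Cmod z < 1)%R.

Definition analytic (f : C -> C) : Prop :=
  forall z : C, disk z -> @ex_derive C_AbsRing C_NormedModule f z.

(** Real partial derivatives, Wirtinger derivatives, and Jacobian determinant
    of a complex-valued function of z = x + iy. *)

Definition partial_x (f : C -> C) (z : C) : C :=
  (Derive (fun t : R => Re (f (t, Im z))) (Re z),
   Derive (fun t : R => Im (f (t, Im z))) (Re z)).

Definition partial_y (f : C -> C) (z : C) : C :=
  (Derive (fun t : R => Re (f (Re z, t))) (Im z),
   Derive (fun t : R => Im (f (Re z, t))) (Im z)).

Definition d_zbar (f : C -> C) (z : C) : C :=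
  (partial_x f z + Ci * partial_y f z) / 2.

Definition jacobian (f : C -> C) (z : C) : R :=
  (Re (partial_x f z) * Im (partial_y f z)
   - Re (partial_y f z) * Im (partial_x f z))%R.

Definition univalent (f : C -> C) : Prop :=
  forall z1 z2 : C, disk z1 -> disk z2 -> f z1 = f z2 -> z1 = z2.

Definition sense_preserving (f : C -> C) : Prop :=
  forall z : C, disk z -> (0 < jacobian f z)%R.

(** f = h + conj g on the disk, with h(z) = z + sum_{n>=2} a_n z^n and
    g(z) = sum_{n>=1} b_n z^n.  This normalization makes h, g, a, b unique. *)
Definition canonical_form (f h g : C -> C) (a b : nat -> C) : Prop :=
  analytic h /\ analytic g /\
  (forall z : C, disk z -> f z = h z + Cconj (g z)) /\
  a 0%nat = 0 /\ a 1%nat = 1 /\ b 0%nat = 0 /\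
  (forall z : C, disk z -> @is_pseries C_AbsRing C_NormedModule a z (h z)) /\
  (forall z : C, disk z -> @is_pseries C_AbsRing C_NormedModule b z (g z)).

Definition S_H (f : C -> C) : Prop :=
  (exists (h g : C -> C) (a b : nat -> C), canonical_form f h g a b) /\
  univalent f /\ sense_preserving f.

(** For f in S_H, h' has no zero in the disk (the Jacobian is
    |h'|^2 - |g'|^2 > 0), so the quotient below is never a division by 0. *)
Definition S_HK (K : R) (f : C -> C) : Prop :=
  S_H f /\
  exists (h g : C -> C) (a b : nat -> C),
    canonical_form f h g a b /\
    forall z : C, disk z ->
      (Cmod (C_derive g z / C_derive h z) <= (K - 1) / (K + 1))%R.

Definition S_HK0 (K : R) (f : C -> C) : Prop :=
  S_HK K f /\ d_zbar f 0 = 0.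

(** The condition h' <> 0 makes the quotient g'/h' meaningful; with Coq's
    total division it is not implied by the equation (take k = 0, h = 0). *)
Definition koebe_shear (k : R) (h g : C -> C) : Prop :=
  analytic h /\ analytic g /\ h 0 = 0 /\ g 0 = 0 /\
  forall z : C, disk z ->
    h z - g z = z / (1 - z) ^ 2 /\
    C_derive h z <> 0 /\
    C_derive g z / C_derive h z = k * z.

Definition Cexp (z : C) : C :=
  (exp (Re z) * cos (Im z), exp (Re z) * sin (Im z))%R.

(** L is the branch on the disk of log ((1 - z) / (1 - k z)) with L(0) = 0. *)
Definition log_branch (k : R) (L : C -> C) : Prop :=
  analytic L /\ L 0 = 0 /\
  forall z : C, disk z -> Cexp (L z) = (1 - z) / (1 - k * z).

Definition A (n : nat) (k : R) : R :=
  (((1 - k) ^ 2 * INR n ^ 2 - 2 * k * (1 - k) * INR n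
    + k * (1 + k) * (1 - k ^ n)) / ((1 - k) ^ 3 * INR n))%R.

Definition B (n : nat) (k : R) : R :=
  ((k * (1 - k) ^ 2 * INR n ^ 2 - 2 * k * (1 - k) * INR n
    + k * (1 + k) * (1 - k ^ n)) / ((1 - k) ^ 3 * INR n))%R.

(* Main.v *)
Require Import Defs.
From Stdlib Require Import Reals Lra Lia Psatz.
From Coquelicot Require Import Coquelicot.
Open Scope C_scope.

(** The shear equations force [h' = (1 + z) / ((1 - z)^3 (1 - k z))] and
    [g' = k z h'], and [(log ((1 - z) / (1 - k z)))' = k / (1 - k z) - 1 / (1 - z)];
    a function on the disk being determined by its derivative and its value
    at 0, this gives uniqueness, the closed form and the power series.

    For univalence write [z = (s - 1) / (s + 1)] with [Re s > 0], so that the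
    Koebe function becomes [(s^2 - 1) / 4] and its imaginary part is
    [Re s * Im s / 2].  As [f] differs from [h - g] by the real number
    [2 Re g], two points with the same image lie on one curve
    [s = p + i c / p], [p > 0], and along it [Re f = Re (h + g)] has derivative
    [(p + c^2 / p^3) / 2 * Re ((1 + k z) / (1 - k z)) > 0]. *)

(** The sign in the univalence step has a simple cause. In the variable [s] the derivative of
    [h + g] is [(s / 2) (1 + k z) / (1 - k z)]; along a level line [Im (s^2) = 2 c] is constant, so
    [s] times the velocity [s'] is real, equal to [p + c^2 / p^3]. What remains is a Cayley
    transform of [k z], whose real part is positive because [|k z| < 1]. Each level line is
    parametrised by all [p > 0], so two points with a common [c] are joined by an arc of the
    half-plane on which [Im (h - g)] is constant: this is the convexity in the real direction on
    which shearing rests. No contour integration occurs. Complex derivatives are traded for real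
    ones through the Cauchy-Riemann equations, and a mean value estimate along rays from 0 does the
    work of integration: with bound 0 it gives uniqueness, with a geometric bound it sums the
    logarithmic series. *)

(** * Complex derivatives and the Cauchy-Riemann equations *)

Definition is_cderive (f : C -> C) (z l : C) : Prop :=
  @is_derive C_AbsRing C_NormedModule f z l.

(** The differential [w => w * l] is linear in any case, and the only limit point of the filter
    [locally z] is [z] itself, so the epsilon-delta estimate is the whole content. *)
Lemma is_cderive_eps (f : C -> C) (z l : C) :
  is_cderive f z l <->
  forall eps : posreal, exists d : posreal, forall w : C,
    (Cmod (w - z) < d)%R ->
    (Cmod (f w - f z - (w - z) * l) <= eps * Cmod (w - z))%R.
Proof.
  split.
  - intros [_ H] eps.
    destruct (H z (fun P HP => HP) eps) as [d Hd].
    exists d; intros w Hw; exact (Hd w Hw).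
  - intros H; split.
    + apply (@is_linear_scal_l C_AbsRing C_NormedModule).
    + intros w Hw eps.
      apply (@is_filter_lim_locally_unique C_AbsRing
               (AbsRing_NormedModule C_AbsRing)) in Hw; subst w.
      destruct (H eps) as [d Hd].
      exists d; intros y Hy; exact (Hd y Hy).
Qed.

Lemma is_cderive_ext (f g : C -> C) (z l : C) :
  (forall w, f w = g w) -> is_cderive f z l -> is_cderive g z l.
Proof. exact (@is_derive_ext C_AbsRing C_NormedModule f g z l). Qed.

Lemma is_cderive_ext_disk (f g : C -> C) (z l : C) :
  disk z -> (forall w, disk w -> f w = g w) ->
  is_cderive f z l -> is_cderive g z l.
Proof.
  unfold disk; intros Hz Hfg.
  apply (@is_derive_ext_loc C_AbsRing C_NormedModule f g z l).
  assert (Hd : (0 < 1 - Cmod z)%R) by lra.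
  exists (mkposreal _ Hd); intros w Hw; apply Hfg.
  change (Cmod (w - z) < 1 - Cmod z)%R in Hw.
  replace w with (z + (w - z)) by ring.
  eapply Rle_lt_trans; [apply Cmod_triangle|lra].
Qed.

(** Product and chain rules are stated for the ring viewed as a module over itself. The two module
    structures on [C] give the same estimate up to conversion; only the linearity part is proved
    afresh. *)
Lemma is_cderive_absring (f : C -> C) (z l : C) :
  is_cderive f z l <->
  @is_derive C_AbsRing (AbsRing_NormedModule C_AbsRing) f z l.
Proof.
  split; intros [_ H]; (split; [apply is_linear_scal_l|exact H]).
Qed.

Lemma is_cderive_mult (f g : C -> C) (z df dg : C) :
  is_cderive f z df -> is_cderive g z dg ->
  is_cderive (fun w => f w * g w) z (df * g z + f z * dg).
Proof.
  rewrite !is_cderive_absring; intros Hf Hg.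
  exact (@is_derive_mult C_AbsRing f g z df dg Hf Hg Cmult_comm).
Qed.

Lemma is_cderive_comp (f g : C -> C) (z df dg : C) :
  is_cderive f (g z) df -> is_cderive g z dg ->
  is_cderive (fun w => f (g w)) z (dg * df).
Proof.
  rewrite (is_cderive_absring g); intros Hf Hg.
  exact (@is_derive_comp C_AbsRing C_NormedModule f g z df dg Hf Hg).
Qed.

Lemma is_cderive_id (z : C) : is_cderive (fun w => w) z 1.
Proof. apply is_cderive_absring; exact (@is_derive_id C_AbsRing z). Qed.

Lemma is_cderive_const (c z : C) : is_cderive (fun _ => c) z 0.
Proof. exact (@is_derive_const C_AbsRing C_NormedModule c z). Qed.

Lemma is_cderive_plus (f g : C -> C) (z df dg : C) :
  is_cderive f z df -> is_cderive g z dg ->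
  is_cderive (fun w => f w + g w) z (df + dg).
Proof. exact (@is_derive_plus C_AbsRing C_NormedModule f g z df dg). Qed.

Lemma is_cderive_minus (f g : C -> C) (z df dg : C) :
  is_cderive f z df -> is_cderive g z dg ->
  is_cderive (fun w => f w - g w) z (df - dg).
Proof. exact (@is_derive_minus C_AbsRing C_NormedModule f g z df dg). Qed.

Lemma is_cderive_scal (c : C) (f : C -> C) (z df : C) :
  is_cderive f z df -> is_cderive (fun w => c * f w) z (c * df).
Proof.
  intros Hf.
  replace (c * df) with (0 * f z + c * df) by ring.
  exact (is_cderive_mult (fun _ => c) f z 0 df (is_cderive_const c z) Hf).
Qed.

Lemma is_cderive_pow (z : C) (n : nat) :
  is_cderive (fun w => w ^ S n) z (INR (S n) * z ^ n).
Proof.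
  induction n as [|n IH].
  - replace (INR 1 * z ^ 0) with (RtoC 1) by (simpl; ring).
    eapply is_cderive_ext; [|apply is_cderive_id].
    intros t; simpl; ring.
  - replace (INR (S (S n)) * z ^ S n)
      with (1 * z ^ S n + z * (INR (S n) * z ^ n)).
    + exact (is_cderive_mult (fun w => w) (fun w => w ^ S n) z _ _
               (is_cderive_id z) IH).
    + rewrite (S_INR (S n)), RtoC_plus, Cpow_S; ring.
Qed.

Lemma Cmod_le_Re_Im (z : C) : (Cmod z <= Rabs (Re z) + Rabs (Im z))%R.
Proof.
  destruct z as [x y].
  replace ((x, y) : C) with (RtoC x + Ci * RtoC y)
    by (unfold Ci, RtoC, Cplus, Cmult; simpl; f_equal; ring).
  eapply Rle_trans; [apply Cmod_triangle|].
  rewrite Cmod_mult, Cmod_Ci, !Cmod_R; simpl.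
  rewrite Rmult_1_l.
  right; f_equal; f_equal; ring.
Qed.

Lemma im_le_Cmod (z : C) : (Rabs (Im z) <= Cmod z)%R.
Proof.
  eapply Rle_trans; [|apply Rmax_Cmod].
  apply Rmax_r.
Qed.

(** Multiplication by [a + i b] is the real linear map with rows [(a, -b)] and [(b, a)]. The rest
    compares [Cmod] with the maximum norm, which agree up to a factor 2; hence the halved [eps] in
    both directions. *)
Lemma is_cderive_cauchy_riemann (f : C -> C) (z l : C) :
  is_cderive f z l <->
  differentiable_pt_lim (fun x y => Re (f (x, y))) (Re z) (Im z) (Re l) (- Im l)
  /\ differentiable_pt_lim (fun x y => Im (f (x, y))) (Re z) (Im z) (Im l) (Re l).
Proof.
  destruct z as [x0 y0]; destruct l as [a b].
  rewrite is_cderive_eps; simpl Re; simpl Im.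
  split.
  - intros H.
    assert (Hloc : forall eps : posreal,
      locally_2d (fun u v =>
        (Cmod (f (u, v) - f (x0, y0) - ((u, v) - (x0, y0)) * (a, b))
         <= eps * Rmax (Rabs (u - x0)) (Rabs (v - y0)))%R) x0 y0).
    { intros eps.
      assert (H2 : (0 < eps / 2)%R) by (destruct eps; simpl; lra).
      destruct (H (mkposreal _ H2)) as [d Hd]; simpl in Hd.
      assert (Hd2 : (0 < d / 2)%R) by (destruct d; simpl; lra).
      exists (mkposreal _ Hd2); simpl; intros u v Hu Hv.
      pose proof (Cmod_le_Re_Im ((u, v) - (x0, y0))) as Hm; simpl in Hm.
      eapply Rle_trans; [apply Hd|].
      - eapply Rle_lt_trans; [apply Hm|].
        unfold Rminus in *; lra.
      - pose proof (Rmax_l (Rabs (u - x0)) (Rabs (v - y0))).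
        pose proof (Rmax_r (Rabs (u - x0)) (Rabs (v - y0))).
        assert (Cmod ((u, v) - (x0, y0)) <=
          2 * Rmax (Rabs (u - x0)) (Rabs (v - y0)))%R
          by (unfold Rminus in *; lra).
        pose proof (cond_pos eps); nra. }
    split; intros eps; destruct (Hloc eps) as [d Hd]; exists d;
      intros u v Hu Hv; specialize (Hd u v Hu Hv);
      (eapply Rle_trans; [|exact Hd]).
    + eapply Rle_trans; [|apply re_le_Cmod].
      right; f_equal; simpl; unfold Re; ring.
    + eapply Rle_trans; [|apply im_le_Cmod].
      right; f_equal; simpl; unfold Im; ring.
  - intros [Hr Hi] eps.
    assert (H2 : (0 < eps / 2)%R) by (destruct eps; simpl; lra).
    destruct (Hr (mkposreal _ H2)) as [d1 Hd1].
    destruct (Hi (mkposreal _ H2)) as [d2 Hd2]; simpl in Hd1, Hd2.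
    assert (Hd : (0 < Rmin d1 d2)%R)
      by (apply Rmin_pos; apply cond_pos).
    exists (mkposreal _ Hd); simpl; intros [u v] Hw.
    pose proof (re_le_Cmod ((u, v) - (x0, y0))) as Hu; simpl in Hu.
    pose proof (im_le_Cmod ((u, v) - (x0, y0))) as Hv; simpl in Hv.
    pose proof (Rmin_l d1 d2); pose proof (Rmin_r d1 d2).
    assert (Hm : (Rmax (Rabs (u - x0)) (Rabs (v - y0))
                 <= Cmod ((u, v) - (x0, y0)))%R)
      by (apply Rmax_lub; unfold Rminus; assumption).
    specialize (Hd1 u v); specialize (Hd2 u v).
    unfold Rminus at 1 2 in Hd1; unfold Rminus at 1 2 in Hd2.
    specialize (Hd1 ltac:(lra) ltac:(lra)).
    specialize (Hd2 ltac:(lra) ltac:(lra)).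
    eapply Rle_trans; [apply Cmod_le_Re_Im|].
    replace (Re (f (u, v) - f (x0, y0) - ((u, v) - (x0, y0)) * (a, b)))
      with (Re (f (u, v)) - Re (f (x0, y0)) - (a * (u - x0) + - b * (v - y0)))%R
      by (simpl; unfold Re; ring).
    replace (Im (f (u, v) - f (x0, y0) - ((u, v) - (x0, y0)) * (a, b)))
      with (Im (f (u, v)) - Im (f (x0, y0)) - (b * (u - x0) + a * (v - y0)))%R
      by (simpl; unfold Im; ring).
    pose proof (cond_pos eps); nra.
Qed.

Lemma is_cderive_inv (z : C) : z <> 0 -> is_cderive Cinv z (- / (z * z)).
Proof.
  intros Hz; apply is_cderive_eps; intros eps.
  assert (Hm : (0 < Cmod z)%R) by (apply Cmod_gt_0; exact Hz).
  pose proof (cond_pos eps) as He.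
  (* The error is [(w - z)^2 / (w z^2)]. The first radius keeps [|w| >= |z| / 2], the second then
     makes [|w - z| / (|w| |z|^2)] at most [eps]. *)
  assert (Hd : (0 < Rmin (Cmod z / 2) (eps * Cmod z ^ 3 / 2))%R).
  { apply Rmin_pos; [lra|].
    pose proof (pow_lt (Cmod z) 3 Hm); nra. }
  exists (mkposreal _ Hd); intros w Hw; cbn [pos] in Hw.
  pose proof (Rmin_l (Cmod z / 2) (eps * Cmod z ^ 3 / 2)).
  pose proof (Rmin_r (Cmod z / 2) (eps * Cmod z ^ 3 / 2)).
  assert (Hwm : (Cmod z / 2 <= Cmod w)%R).
  { pose proof (Cmod_triangle w (- (w - z))) as Ht.
    rewrite Cmod_opp in Ht.
    replace (w + - (w - z)) with z in Ht by ring; lra. }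
  assert (Hw0 : w <> 0) by (apply (proj2 (Cmod_gt_0 w)); lra).
  replace (/ w - / z - (w - z) * - / (z * z))
    with ((w - z) * (w - z) / (w * (z * z))) by (field; auto).
  rewrite Cmod_div by (repeat apply Cmult_neq_0; auto).
  rewrite !Cmod_mult.
  set (a := Cmod (w - z)) in *; set (m := Cmod z) in *; set (n := Cmod w) in *.
  assert (Ha : (0 <= a)%R) by apply Cmod_ge_0.
  assert (Hn : (0 < n * (m * m))%R) by (apply Rmult_lt_0_compat; nra).
  apply (Rmult_le_reg_r (n * (m * m))); [exact Hn|].
  unfold Rdiv; rewrite Rmult_assoc, Rinv_l, Rmult_1_r by lra.
  assert (m / 2 * (m * m) <= n * (m * m))%R by (apply Rmult_le_compat_r; nra).
  assert (a <= eps * (n * (m * m)))%R.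
  { apply Rle_trans with (eps * (m / 2 * (m * m)))%R; [|nra].
    replace (eps * (m / 2 * (m * m)))%R with (eps * m ^ 3 / 2)%R by field; lra. }
  nra.
Qed.

(** Real chain rule applied to both Cauchy-Riemann components. It serves three kinds of curves: rays
    from 0, the level lines of the univalence proof, and the coordinate lines that define the
    partial derivatives. *)
Lemma is_cderive_curve (f : C -> C) (x y : R -> R) (t x' y' : R) (l : C) :
  is_cderive f (x t, y t) l -> is_derive x t x' -> is_derive y t y' ->
  is_derive (fun s => Re (f (x s, y s))) t (Re (l * (x', y'))) /\
  is_derive (fun s => Im (f (x s, y s))) t (Im (l * (x', y'))).
Proof.
  intros Hf Hx Hy.
  apply is_cderive_cauchy_riemann in Hf; simpl Re in Hf; simpl Im in Hf.
  destruct Hf as [Hr Hi].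
  apply is_derive_Reals in Hx; apply is_derive_Reals in Hy.
  split; apply is_derive_Reals.
  - replace (Re (l * (x', y'))) with (Re l * x' + - Im l * y')%R
      by (simpl; unfold Re, Im; ring).
    exact (derivable_pt_lim_comp_2d (fun u v => Re (f (u, v))) x y t _ _ _ _
             Hr Hx Hy).
  - replace (Im (l * (x', y'))) with (Im l * x' + Re l * y')%R
      by (simpl; unfold Re, Im; ring).
    exact (derivable_pt_lim_comp_2d (fun u v => Im (f (u, v))) x y t _ _ _ _
             Hi Hx Hy).
Qed.

(** * The mean value estimate on rays *)

Lemma Cmod_scal_pair (t : R) (z : C) :
  Cmod ((t * Re z)%R, (t * Im z)%R) = (Rabs t * Cmod z)%R.
Proof.
  rewrite <- Cmod_R, <- Cmod_mult; f_equal.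
  destruct z as [x y]; unfold RtoC, Cmult; simpl; f_equal; ring.
Qed.

(** The real mean value theorem is applied to the real and imaginary parts of [t => f (t z)]
    separately. They yield different intermediate points [c1] and [c2], which costs the factor 2; it
    is harmless because [M] is later 0 or tends to 0. *)
Lemma Cmod_ray_increment_le (f df : C -> C) (z : C) (M : R) :
  disk z -> (forall w, disk w -> is_cderive f w (df w)) ->
  (forall w, (Cmod w <= Cmod z)%R -> (Cmod (df w) <= M)%R) ->
  (Cmod (f z - f 0) <= 2 * (M * Cmod z))%R.
Proof.
  unfold disk; intros Hz Hf HM.
  assert (Hray : forall t, (0 <= t <= 1)%R ->
    (Cmod ((t * Re z)%R, (t * Im z)%R) <= Cmod z)%R).
  { intros t Ht; rewrite Cmod_scal_pair, Rabs_right by lra.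
    pose proof (Cmod_ge_0 z); nra. }
  set (d := fun t : R => df ((t * Re z)%R, (t * Im z)%R) * (Re z, Im z)).
  assert (HD : forall t, (0 <= t <= 1)%R ->
    is_derive (fun s => Re (f ((s * Re z)%R, (s * Im z)%R))) t (Re (d t)) /\
    is_derive (fun s => Im (f ((s * Re z)%R, (s * Im z)%R))) t (Im (d t))).
  { intros t Ht; unfold d.
    apply (is_cderive_curve f (fun s => (s * Re z)%R) (fun s => (s * Im z)%R)).
    - apply Hf; eapply Rle_lt_trans; [apply Hray; exact Ht|exact Hz].
    - auto_derive; [exact I|ring].
    - auto_derive; [exact I|ring]. }
  assert (Hd : forall t, (0 <= t <= 1)%R -> (Cmod (d t) <= M * Cmod z)%R).
  { intros t Ht; unfold d; rewrite Cmod_mult.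
    replace (Re z, Im z) with z by (destruct z; reflexivity).
    apply Rmult_le_compat_r; [apply Cmod_ge_0|apply HM, Hray, Ht]. }
  assert (Hmin : Rmin 0 1 = 0%R) by (apply Rmin_left; lra).
  assert (Hmax : Rmax 0 1 = 1%R) by (apply Rmax_right; lra).
  assert (E1 : f ((1 * Re z)%R, (1 * Im z)%R) = f z)
    by (f_equal; destruct z; simpl; f_equal; ring).
  assert (E0 : f ((0 * Re z)%R, (0 * Im z)%R) = f 0)
    by (f_equal; unfold RtoC; f_equal; ring).
  destruct (MVT_gen (fun s => Re (f ((s * Re z)%R, (s * Im z)%R))) 0 1
              (fun t => Re (d t))) as [c1 [Hc1 E]].
  { rewrite Hmin, Hmax; intros t Ht; apply HD; lra. }
  { rewrite Hmin, Hmax; intros t Ht.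
    apply continuity_pt_filterlim.
    apply (ex_derive_continuous (fun s => Re (f ((s * Re z)%R, (s * Im z)%R)))).
    eexists; apply (HD t); lra. }
  destruct (MVT_gen (fun s => Im (f ((s * Re z)%R, (s * Im z)%R))) 0 1
              (fun t => Im (d t))) as [c2 [Hc2 E']].
  { rewrite Hmin, Hmax; intros t Ht; apply HD; lra. }
  { rewrite Hmin, Hmax; intros t Ht.
    apply continuity_pt_filterlim.
    apply (ex_derive_continuous (fun s => Im (f ((s * Re z)%R, (s * Im z)%R)))).
    eexists; apply (HD t); lra. }
  rewrite Hmin, Hmax in Hc1, Hc2.
  rewrite E1, E0 in E, E'.
  eapply Rle_trans; [apply Cmod_le_Re_Im|].
  replace (Re (f z - f 0)) with (Re (d c1))
    by (transitivity (Re (f z) - Re (f 0))%R; [rewrite E; ring|reflexivity]).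
  replace (Im (f z - f 0)) with (Im (d c2))
    by (transitivity (Im (f z) - Im (f 0))%R; [rewrite E'; ring|reflexivity]).
  pose proof (re_le_Cmod (d c1)); pose proof (im_le_Cmod (d c2)).
  pose proof (Hd c1 Hc1); pose proof (Hd c2 Hc2); lra.
Qed.

Lemma eq_on_disk_of_derive (f g df : C -> C) :
  (forall w, disk w -> is_cderive f w (df w)) ->
  (forall w, disk w -> is_cderive g w (df w)) ->
  f 0 = g 0 -> forall z, disk z -> f z = g z.
Proof.
  intros Hf Hg H0 z Hz.
  assert (H : (Cmod ((f z - g z) - (f 0 - g 0)) <= 2 * (0 * Cmod z))%R).
  { apply (Cmod_ray_increment_le (fun w => f w - g w) (fun w => df w - df w));
      [exact Hz| |].
    - intros w Hw; apply is_cderive_minus; auto.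
    - intros w _; right.
      replace (df w - df w) with (RtoC 0) by ring; apply Cmod_0. }
  rewrite H0 in H.
  replace (f z - g z - (g 0 - g 0)) with (f z - g z) in H by ring.
  assert (E : f z - g z = 0).
  { apply Cmod_eq_0; pose proof (Cmod_ge_0 (f z - g z)); lra. }
  replace (f z) with (f z - g z + g z) by ring; rewrite E; ring.
Qed.

(** * The complex exponential and the principal logarithm on the right half-plane *)

Lemma differentiable_pt_lim_of_partials (f dfx : R -> R -> R) (x y dfy : R) :
  locally (x, y) (fun u : R * R =>
    is_derive (fun t : R => f t (snd u)) (fst u) (dfx (fst u) (snd u))) ->
  is_derive (fun t : R => f x t) y dfy ->
  continuous (fun u : R * R => dfx (fst u) (snd u)) (x, y) ->
  differentiable_pt_lim f x y (dfx x y) dfy.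
Proof.
  intros Hx Hy Hc; apply filterdiff_differentiable_pt_lim.
  exact (is_derive_filterdiff f x y dfx dfy Hx Hy Hc).
Qed.

Lemma continuous_fst_comp (f : R -> R) (u : R * R) :
  ex_derive f (fst u) -> continuous (fun v : R * R => f (fst v)) u.
Proof.
  intros Hf; apply (continuous_comp (fun v : R * R => fst v) f).
  - apply continuous_fst.
  - exact (ex_derive_continuous f (fst u) Hf).
Qed.

Lemma continuous_snd_comp (f : R -> R) (u : R * R) :
  ex_derive f (snd u) -> continuous (fun v : R * R => f (snd v)) u.
Proof.
  intros Hf; apply (continuous_comp (fun v : R * R => snd v) f).
  - apply continuous_snd.
  - exact (ex_derive_continuous f (snd u) Hf).
Qed.

Lemma is_cderive_Cexp (z : C) : is_cderive Cexp z (Cexp z).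
Proof.
  apply is_cderive_cauchy_riemann; destruct z as [x y]; simpl Re; simpl Im.
  split.
  - apply (differentiable_pt_lim_of_partials
      (fun u v => exp u * cos v)%R (fun u v => exp u * cos v)%R).
    + apply filter_forall; intros u; auto_derive; [exact I|ring].
    + auto_derive; [exact I|ring].
    + apply (continuous_mult (fun u : R * R => exp (fst u)) (fun u => cos (snd u))).
      * apply continuous_fst_comp; auto_derive; exact I.
      * apply continuous_snd_comp; auto_derive; exact I.
  - apply (differentiable_pt_lim_of_partials
      (fun u v => exp u * sin v)%R (fun u v => exp u * sin v)%R).
    + apply filter_forall; intros u; auto_derive; [exact I|ring].
    + auto_derive; [exact I|ring].
    + apply (continuous_mult (fun u : R * R => exp (fst u)) (fun u => sin (snd u))).
      * apply continuous_fst_comp; auto_derive; exact I.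
      * apply continuous_snd_comp; auto_derive; exact I.
Qed.

(** Principal logarithm, meant for [Re z > 0] only: there the argument is [atan (y / x)], and
    [ln |z|] is half of [ln (|z|^2)]. *)
Definition Clog (z : C) : C :=
  ((ln (Re z ^ 2 + Im z ^ 2) / 2)%R, atan (Im z / Re z)).

Lemma Cexp_Clog (z : C) : (0 < Re z)%R -> Cexp (Clog z) = z.
Proof.
  destruct z as [x y]; unfold Cexp, Clog, Re, Im, fst, snd; intros Hx.
  assert (Hs : (0 < x ^ 2 + y ^ 2)%R) by nra.
  assert (E : exp (ln (x ^ 2 + y ^ 2) / 2) = sqrt (x ^ 2 + y ^ 2)).
  { rewrite <- Rpower_sqrt by exact Hs; unfold Rpower; f_equal; field. }
  assert (Eq : (x ^ 2 + y ^ 2 = x ^ 2 * (1 + (y / x)²))%R)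
    by (unfold Rsqr; field; lra).
  assert (H1 : (0 < 1 + (y / x)²)%R) by (pose proof (Rle_0_sqr (y / x)); lra).
  assert (Hq : sqrt (x ^ 2 + y ^ 2) = (x * sqrt (1 + (y / x)²))%R).
  { rewrite Eq, sqrt_mult, sqrt_pow2 by nra; reflexivity. }
  pose proof (sqrt_lt_R0 _ H1).
  rewrite E, cos_atan, sin_atan, Hq; f_equal; field; lra.
Qed.

Lemma locally_fst_pos (x y : R) :
  (0 < x)%R -> locally (x, y) (fun u : R * R => (0 < fst u)%R).
Proof.
  intros Hx; exists (mkposreal x Hx); intros [u v] [Hu _]; simpl in *.
  unfold ball in Hu; simpl in Hu; unfold AbsRing_ball in Hu; simpl in Hu.
  unfold abs, minus, plus, opp in Hu; simpl in Hu.
  apply Rabs_def2 in Hu; lra.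
Qed.

Lemma continuous_sum_squares (u : R * R) :
  continuous (fun v : R * R => (fst v ^ 2 + snd v ^ 2)%R) u.
Proof.
  apply (continuous_plus (fun v : R * R => (fst v ^ 2)%R)
           (fun v : R * R => (snd v ^ 2)%R)).
  - apply (continuous_fst_comp (fun t => t ^ 2)%R); auto_derive; exact I.
  - apply (continuous_snd_comp (fun t => t ^ 2)%R); auto_derive; exact I.
Qed.

Lemma continuous_inv_sum_squares (u : R * R) :
  (0 < fst u)%R -> continuous (fun v : R * R => (/ (fst v ^ 2 + snd v ^ 2))%R) u.
Proof.
  intros Hu.
  apply (continuous_comp (fun v : R * R => (fst v ^ 2 + snd v ^ 2)%R) Rinv).
  - apply continuous_sum_squares.
  - apply (ex_derive_continuous Rinv); auto_derive; nra.
Qed.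

Lemma is_cderive_Clog (z : C) : (0 < Re z)%R -> is_cderive Clog z (/ z).
Proof.
  intros Hz; apply is_cderive_cauchy_riemann.
  destruct z as [x y]; simpl in Hz |- *.
  assert (Hs : (0 < x ^ 2 + y ^ 2)%R) by nra.
  split.
  - replace (x / (x * (x * 1) + y * (y * 1)))%R
      with (x * / (x ^ 2 + y ^ 2))%R by reflexivity.
    apply (differentiable_pt_lim_of_partials
      (fun u v => ln (u ^ 2 + v ^ 2) / 2)%R (fun u v => u * / (u ^ 2 + v ^ 2))%R).
    + eapply filter_imp; [|apply (locally_fst_pos x y Hz)].
      intros [u v]; simpl; intros Hu; auto_derive; [nra|field; nra].
    + auto_derive; [nra|field; nra].
    + apply (continuous_mult (fun u : R * R => fst u)
               (fun u => / (fst u ^ 2 + snd u ^ 2))%R).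
      * apply continuous_fst.
      * apply continuous_inv_sum_squares; exact Hz.
  - replace (- y / (x * (x * 1) + y * (y * 1)))%R
      with (- y * / (x ^ 2 + y ^ 2))%R by reflexivity.
    apply (differentiable_pt_lim_of_partials
      (fun u v => atan (v / u))%R (fun u v => - v * / (u ^ 2 + v ^ 2))%R).
    + eapply filter_imp; [|apply (locally_fst_pos x y Hz)].
      intros [u v]; simpl; intros Hu; auto_derive; [lra|unfold Rsqr; field; split; nra].
    + auto_derive; [lra|unfold Rsqr; field; split; nra].
    + apply (continuous_mult (fun u : R * R => - snd u)%R
               (fun u => / (fst u ^ 2 + snd u ^ 2))%R).
      * apply (continuous_snd_comp Ropp); auto_derive; exact I.
      * apply continuous_inv_sum_squares; exact Hz.
Qed.

(** * Differentiation of explicit formulas *)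

Lemma is_cderive_eq (f : C -> C) (z l l' : C) :
  is_cderive f z l -> l = l' -> is_cderive f z l'.
Proof. intros H <-; exact H. Qed.

Lemma is_cderive_div (f g : C -> C) (z df dg : C) :
  g z <> 0 -> is_cderive f z df -> is_cderive g z dg ->
  is_cderive (fun w => f w / g w) z ((df * g z - f z * dg) / (g z * g z)).
Proof.
  intros H0 Hf Hg; unfold Cdiv.
  eapply is_cderive_eq.
  - apply (is_cderive_mult f (fun w => / g w)); [exact Hf|].
    apply (is_cderive_comp Cinv g); [apply is_cderive_inv; exact H0|exact Hg].
  - field; exact H0.
Qed.

Lemma is_cderive_pow_comp (f : C -> C) (n : nat) (z df : C) :
  is_cderive f z df ->
  is_cderive (fun w => f w ^ S n) z (df * (INR (S n) * f z ^ n)).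
Proof.
  intros Hf; apply (is_cderive_comp (fun w => w ^ S n) f); [|exact Hf].
  apply is_cderive_pow.
Qed.

(** Differentiates by the shape of the formula, producing the derivative as an unsimplified
    expression to be reconciled through [is_cderive_eq]. Constants are recognised before compound
    terms, unknown functions are closed by hypotheses, and nonvanishing of denominators is left as
    goals. *)
Ltac cderive :=
  lazymatch goal with
  | |- is_cderive (fun w => w) _ _ => apply is_cderive_id
  | |- is_cderive (fun _ => ?c) _ _ => apply is_cderive_const
  | |- is_cderive (fun w => @?u w + @?v w) _ _ =>
      eapply (is_cderive_plus u v); cderive
  | |- is_cderive (fun w => @?u w - @?v w) _ _ =>
      eapply (is_cderive_minus u v); cderive
  | |- is_cderive (fun w => @?u w / @?v w) _ _ =>
      eapply (is_cderive_div u v); cderive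
  | |- is_cderive (fun w => @?u w * @?v w) _ _ =>
      eapply (is_cderive_mult u v); cderive
  | |- is_cderive (fun w => @?u w ^ S ?n) _ _ =>
      eapply (is_cderive_pow_comp u n); cderive
  | |- is_cderive _ _ _ => eassumption
  | _ => idtac
  end.

Lemma is_cderive_unique (f : C -> C) (z l l' : C) :
  is_cderive f z l -> is_cderive f z l' -> l = l'.
Proof.
  intros H H'.
  rewrite <- (is_C_derive_unique f z l H); exact (is_C_derive_unique f z l' H').
Qed.

Lemma analytic_is_cderive (f : C -> C) (z : C) :
  analytic f -> disk z -> is_cderive f z (C_derive f z).
Proof. intros Hf Hz; exact (C_derive_correct f z 0 (Hf z Hz)). Qed.

(** * Elementary geometry of the disk and the branch of the logarithm *)

Lemma disk_0 : disk 0.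
Proof. unfold disk; rewrite Cmod_0; lra. Qed.

Lemma disk_RtoC (k : R) : (0 <= k < 1)%R -> disk k.
Proof. intros Hk; unfold disk; rewrite Cmod_R, Rabs_right; lra. Qed.

Lemma disk_scal (k : R) (z : C) : (0 <= k < 1)%R -> disk z -> disk (k * z).
Proof.
  unfold disk; intros Hk Hz; rewrite Cmod_mult, Cmod_R, Rabs_right by lra.
  pose proof (Cmod_ge_0 z); nra.
Qed.

Lemma disk_Re_sub (z : C) : disk z -> (0 < Re (1 - z))%R.
Proof.
  unfold disk; intros Hz; pose proof (re_le_Cmod z) as H.
  apply Rabs_le_between in H.
  change (Re (1 - z)) with (1 - Re z)%R; lra.
Qed.

Lemma Cmod_one_minus_ge (z : C) : (1 - Cmod z <= Cmod (1 - z))%R.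
Proof.
  pose proof (Cmod_triangle (1 - z) z) as H.
  replace (1 - z + z) with (RtoC 1) in H by ring.
  rewrite Cmod_1 in H; lra.
Qed.

Lemma disk_sub_neq0 (z : C) : disk z -> 1 - z <> 0.
Proof.
  unfold disk; intros Hz; apply (proj2 (Cmod_gt_0 _)).
  pose proof (Cmod_one_minus_ge z); lra.
Qed.

Lemma Cexp_add (z w : C) : Cexp (z + w) = Cexp z * Cexp w.
Proof.
  destruct z as [a b], w as [c d]; unfold Cexp, Cplus, Cmult, Re, Im, fst, snd.
  rewrite exp_plus, cos_plus, sin_plus; f_equal; ring.
Qed.

(** Differentiate [Cexp (L z) = (1 - z) / (1 - k z)] by the chain rule and divide by [Cexp (L z)].
    The result depends on [k] and [z] only, which is why the branch is unique. *)
Lemma log_branch_derive (k : R) (L : C -> C) (z : C) :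
  (0 <= k < 1)%R -> log_branch k L -> disk z ->
  is_cderive L z (k / (1 - k * z) - 1 / (1 - z)).
Proof.
  intros Hk [HL [_ He]] Hz.
  pose proof (analytic_is_cderive L z HL Hz) as HLz.
  pose proof (disk_sub_neq0 z Hz) as H1.
  pose proof (disk_sub_neq0 _ (disk_scal k z Hk Hz)) as H2.
  pose proof (is_cderive_comp Cexp L z _ _ (is_cderive_Cexp (L z)) HLz) as H.
  apply (is_cderive_ext_disk _ (fun w => (1 - w) / (1 - k * w)) _ _ Hz He) in H.
  assert (H' : is_cderive (fun w => (1 - w) / (1 - k * w)) z
    (((k - 1) / ((1 - k * z) * (1 - k * z))))).
  { clear H; eapply is_cderive_eq; [cderive; exact H2|field; exact H2]. }
  pose proof (is_cderive_unique _ _ _ _ H H') as E.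
  rewrite (He z Hz) in E.
  eapply is_cderive_eq; [exact HLz|].
  replace (C_derive L z)
    with (C_derive L z * ((1 - z) / (1 - k * z)) * ((1 - k * z) / (1 - z)))
    by (field; auto).
  rewrite E; field; auto.
Qed.

Lemma log_branch_unique (k : R) (L L' : C -> C) :
  (0 <= k < 1)%R -> log_branch k L -> log_branch k L' ->
  forall z, disk z -> L z = L' z.
Proof.
  intros Hk HL HL'.
  apply (eq_on_disk_of_derive L L' (fun z => k / (1 - k * z) - 1 / (1 - z))).
  - intros w Hw; apply log_branch_derive; assumption.
  - intros w Hw; apply log_branch_derive; assumption.
  - rewrite (proj1 (proj2 HL)), (proj1 (proj2 HL')); reflexivity.
Qed.

(** Both [1 - z] and [1 - k z] lie in the right half-plane when [|z| < 1], so each has its own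
    principal logarithm and the difference is analytic. *)
Lemma log_branch_Clog (k : R) :
  (0 <= k < 1)%R -> log_branch k (fun z => Clog (1 - z) - Clog (1 - k * z)).
Proof.
  intros Hk; split; [|split].
  - intros z Hz; eexists.
    apply (is_cderive_minus (fun w => Clog (1 - w)) (fun w => Clog (1 - k * w))).
    + apply (is_cderive_comp Clog (fun w => 1 - w)); [|cderive].
      apply is_cderive_Clog, disk_Re_sub, Hz.
    + apply (is_cderive_comp Clog (fun w => 1 - k * w)); [|cderive].
      apply is_cderive_Clog, disk_Re_sub, disk_scal; assumption.
  - replace (1 - k * 0) with (1 - 0) by ring; ring.
  - intros z Hz.
    pose proof (disk_scal k z Hk Hz) as Hkz.
    assert (E : Cexp (Clog (1 - z) - Clog (1 - k * z)) * (1 - k * z) = 1 - z).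
    { rewrite <- (Cexp_Clog (1 - k * z)) at 2 by (apply disk_Re_sub, Hkz).
      rewrite <- Cexp_add.
      replace (Clog (1 - z) - Clog (1 - k * z) + Clog (1 - k * z))
        with (Clog (1 - z)) by ring.
      apply Cexp_Clog, disk_Re_sub, Hz. }
    rewrite <- E at 2; field; apply disk_sub_neq0, Hkz.
Qed.

(** * Explicit solution of the shear equations *)

(** Antiderivative of [shear_dh] by partial fractions, written in the functions [z / (1 - z)^2],
    [z / (1 - z)] and [L], whose Taylor coefficients are [n], 1 and [(k^n - 1) / n]. In [shear_g]
    only the first term changes, by the factor [k], so that the difference is the Koebe function. *)
Definition shear_h (k : R) (L : C -> C) (z : C) : C :=
  z / ((1 - k) * (1 - z) ^ 2) - 2 * k * z / ((1 - k) ^ 2 * (1 - z))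
  - k * (1 + k) / (1 - k) ^ 3 * L z.

Definition shear_g (k : R) (L : C -> C) (z : C) : C :=
  k * z / ((1 - k) * (1 - z) ^ 2) - 2 * k * z / ((1 - k) ^ 2 * (1 - z))
  - k * (1 + k) / (1 - k) ^ 3 * L z.

Definition shear_dh (k : R) (z : C) : C :=
  (1 + z) / ((1 - z) ^ 3 * (1 - k * z)).

Lemma disk_add_neq0 (z : C) : disk z -> 1 + z <> 0.
Proof.
  intros Hz; replace (1 + z) with (1 - - z) by ring.
  apply disk_sub_neq0; unfold disk; rewrite Cmod_opp; exact Hz.
Qed.

Lemma shear_dh_neq0 (k : R) (z : C) :
  (0 <= k < 1)%R -> disk z -> shear_dh k z <> 0.
Proof.
  intros Hk Hz E.
  apply (disk_add_neq0 z Hz).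
  pose proof (disk_sub_neq0 z Hz).
  pose proof (disk_sub_neq0 _ (disk_scal k z Hk Hz)).
  replace (1 + z) with (shear_dh k z * ((1 - z) ^ 3 * (1 - k * z)))
    by (unfold shear_dh; field; auto).
  rewrite E; ring.
Qed.

Lemma is_cderive_shear_h (k : R) (L : C -> C) (z : C) :
  (0 <= k < 1)%R -> log_branch k L -> disk z ->
  is_cderive (shear_h k L) z (shear_dh k z).
Proof.
  intros Hk HL Hz.
  pose proof (log_branch_derive k L z Hk HL Hz) as HLz.
  pose proof (disk_sub_neq0 z Hz).
  pose proof (disk_sub_neq0 _ (disk_RtoC k Hk)).
  pose proof (disk_sub_neq0 _ (disk_scal k z Hk Hz)).
  unfold shear_h; eapply is_cderive_eq.
  - cderive; apply Cmult_neq_0; first [assumption | apply Cpow_nz; assumption].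
  - unfold shear_dh; simpl INR; rewrite ?RtoC_plus; field; auto.
Qed.

Lemma is_cderive_shear_g (k : R) (L : C -> C) (z : C) :
  (0 <= k < 1)%R -> log_branch k L -> disk z ->
  is_cderive (shear_g k L) z (k * z * shear_dh k z).
Proof.
  intros Hk HL Hz.
  pose proof (log_branch_derive k L z Hk HL Hz) as HLz.
  pose proof (disk_sub_neq0 z Hz).
  pose proof (disk_sub_neq0 _ (disk_RtoC k Hk)).
  pose proof (disk_sub_neq0 _ (disk_scal k z Hk Hz)).
  unfold shear_g; eapply is_cderive_eq.
  - cderive; apply Cmult_neq_0; first [assumption | apply Cpow_nz; assumption].
  - unfold shear_dh; simpl INR; rewrite ?RtoC_plus; field; auto.
Qed.

Lemma koebe_shear_of_log (k : R) (L : C -> C) :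
  (0 <= k < 1)%R -> log_branch k L -> koebe_shear k (shear_h k L) (shear_g k L).
Proof.
  intros Hk HL.
  pose proof (disk_sub_neq0 _ (disk_RtoC k Hk)).
  split; [|split; [|split; [|split]]].
  - intros z Hz; eexists; apply is_cderive_shear_h; assumption.
  - intros z Hz; eexists; apply is_cderive_shear_g; assumption.
  - unfold shear_h; rewrite (proj1 (proj2 HL)); field; auto using disk_sub_neq0, disk_0.
  - unfold shear_g; rewrite (proj1 (proj2 HL)); field; auto using disk_sub_neq0, disk_0.
  - intros z Hz.
    pose proof (disk_sub_neq0 z Hz).
    pose proof (shear_dh_neq0 k z Hk Hz).
    rewrite (is_C_derive_unique _ _ _ (is_cderive_shear_h k L z Hk HL Hz)).
    rewrite (is_C_derive_unique _ _ _ (is_cderive_shear_g k L z Hk HL Hz)).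
    split; [|split].
    + unfold shear_h, shear_g; field; auto.
    + assumption.
    + field; assumption.
Qed.

(** Since [h' <> 0], the quotient equation becomes [g' = k z h']; substituted into the derivative of
    [h - g] it leaves [(1 - k z) h' = (1 + z) / (1 - z)^3]. *)
Lemma koebe_shear_derive (k : R) (h g : C -> C) (z : C) :
  (0 <= k < 1)%R -> koebe_shear k h g -> disk z ->
  is_cderive h z (shear_dh k z) /\ is_cderive g z (k * z * shear_dh k z).
Proof.
  intros Hk [Hh [Hg [_ [_ H]]]] Hz.
  pose proof (disk_sub_neq0 z Hz) as H1.
  pose proof (disk_sub_neq0 _ (disk_scal k z Hk Hz)) as H2.
  pose proof (analytic_is_cderive h z Hh Hz) as Hhz.
  pose proof (analytic_is_cderive g z Hg Hz) as Hgz.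
  destruct (H z Hz) as [_ [Hn Hq]].
  assert (Eg : C_derive g z = k * z * C_derive h z)
    by (rewrite <- Hq; field; exact Hn).
  assert (HF : is_cderive (fun w => h w - g w) z ((1 + z) / (1 - z) ^ 3)).
  { apply (is_cderive_ext_disk (fun w => w / (1 - w) ^ 2)); [exact Hz| |].
    - intros w Hw; symmetry; apply (H w Hw).
    - eapply is_cderive_eq.
      + cderive; apply Cpow_nz; exact H1.
      + simpl INR; rewrite ?RtoC_plus; field; auto. }
  pose proof (is_cderive_unique _ _ _ _ HF
    (is_cderive_minus h g z _ _ Hhz Hgz)) as E.
  assert (Eh : C_derive h z = shear_dh k z).
  { transitivity ((C_derive h z - C_derive g z) / (1 - k * z)).
    - rewrite Eg; field; exact H2.
    - rewrite <- E; unfold shear_dh; field; auto. }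
  rewrite Eg in Hgz; rewrite Eh in Hhz, Hgz; split; assumption.
Qed.

Lemma koebe_shear_unique (k : R) (h g h' g' : C -> C) :
  (0 <= k < 1)%R -> koebe_shear k h g -> koebe_shear k h' g' ->
  forall z, disk z -> h z = h' z /\ g z = g' z.
Proof.
  intros Hk H H' z Hz.
  destruct (H) as [_ [_ [Eh [Eg _]]]], (H') as [_ [_ [Eh' [Eg' _]]]].
  split.
  - apply (eq_on_disk_of_derive h h' (shear_dh k)); [| |congruence|exact Hz];
      intros w Hw; eapply koebe_shear_derive; eassumption.
  - apply (eq_on_disk_of_derive g g' (fun w => k * w * shear_dh k w));
      [| |congruence|exact Hz];
      intros w Hw; eapply koebe_shear_derive; eassumption.
Qed.

(** * Complex series *)

Notation is_cseries := (@is_series C_AbsRing C_NormedModule).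

Lemma sum_n_cseries_S (a : nat -> C) (n : nat) :
  @sum_n (NormedModule.AbelianMonoid C_AbsRing C_NormedModule) a (S n)
  = @sum_n (NormedModule.AbelianMonoid C_AbsRing C_NormedModule) a n + a (S n).
Proof. exact (sum_Sn _ n). Qed.

(** The common route to the three basic sums: [s] gives the partial sums explicitly and [u] is a
    real majorant of their distance to the limit. *)
Lemma is_cseries_of_partial_sums (a s : nat -> C) (l : C) (u : nat -> R) :
  s 0%nat = a 0%nat -> (forall n, s (S n) = s n + a (S n)) ->
  (forall n, (Cmod (s n - l) <= u n)%R) -> is_lim_seq u 0 ->
  is_cseries a l.
Proof.
  intros H0 HS Hu Hlim.
  assert (E : forall n,
    @sum_n (NormedModule.AbelianMonoid C_AbsRing C_NormedModule) a n = s n).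
  { induction n as [|n IH].
    - rewrite sum_O, H0; reflexivity.
    - rewrite sum_n_cseries_S, IH, HS; reflexivity. }
  apply (filterlim_locally_ball_norm (U := C_NormedModule)).
  intros eps.
  apply is_lim_seq_spec in Hlim; destruct (Hlim eps) as [N HN].
  exists N; intros n Hn; specialize (HN n Hn).
  change (Cmod (@sum_n (NormedModule.AbelianMonoid C_AbsRing C_NormedModule) a n - l)
          < eps)%R.
  rewrite E; eapply Rle_lt_trans; [apply Hu|].
  apply Rabs_def2 in HN; lra.
Qed.

Lemma is_cseries_conj (a : nat -> C) (l : C) :
  is_cseries a l -> is_cseries (fun n => Cconj (a n)) (Cconj l).
Proof.
  intros H.
  apply (filterlim_locally_ball_norm (U := C_NormedModule)); intros eps.
  assert (E : forall n,
    @sum_n (NormedModule.AbelianMonoid C_AbsRing C_NormedModule)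
      (fun i => Cconj (a i)) n
    = Cconj (@sum_n (NormedModule.AbelianMonoid C_AbsRing C_NormedModule) a n)).
  { induction n as [|n IH].
    - rewrite !sum_O; reflexivity.
    - rewrite !sum_n_cseries_S, IH, Cplus_conj; reflexivity. }
  eapply filter_imp;
    [|exact (proj1 (filterlim_locally_ball_norm (U := C_NormedModule) _ _) H eps)].
  intros n Hn.
  change (Cmod (@sum_n (NormedModule.AbelianMonoid C_AbsRing C_NormedModule)
    (fun i => Cconj (a i)) n - Cconj l) < eps)%R.
  rewrite E, <- Cminus_conj, Cmod_conj; exact Hn.
Qed.

Lemma is_cseries_plus (a b : nat -> C) (la lb : C) :
  is_cseries a la -> is_cseries b lb ->
  is_cseries (fun n => a n + b n) (la + lb).
Proof. exact (@is_series_plus C_AbsRing C_NormedModule a b la lb). Qed.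

Lemma is_cseries_scal (c : C) (a : nat -> C) (l : C) :
  is_cseries a l -> is_cseries (fun n => c * a n) (c * l).
Proof. exact (@is_series_scal C_AbsRing C_NormedModule c a l). Qed.

Lemma is_cseries_shift (a : nat -> C) (l : C) :
  is_cseries a l -> is_cseries (fun n => a (S n)) (l - a 0%nat).
Proof.
  intros H; apply (@is_series_incr_1 C_AbsRing C_NormedModule a).
  change (is_cseries a (l - a 0%nat + a 0%nat)).
  replace (l - a 0%nat + a 0%nat) with l by ring; exact H.
Qed.

Lemma is_cseries_ext (a b : nat -> C) (l : C) :
  (forall n, a n = b n) -> is_cseries a l -> is_cseries b l.
Proof. exact (@is_series_ext C_AbsRing C_NormedModule a b l). Qed.

Lemma pow_n_Cpow (z : C) (n : nat) : @pow_n C_Ring z n = z ^ n.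
Proof.
  induction n as [|n IH]; [reflexivity|].
  rewrite Cpow_S, <- IH; reflexivity.
Qed.

(** The coefficients carry a factor [1 / n], so the series are handled from exponent 1 on; a
    vanishing constant term restores the power series. *)
Lemma is_pseries_of_shifted (a : nat -> C) (z l : C) :
  a 0%nat = 0 -> is_cseries (fun n => a (S n) * z ^ S n) l ->
  @is_pseries C_AbsRing C_NormedModule a z l.
Proof.
  intros H0 H; unfold is_pseries.
  apply (is_cseries_ext (fun n => a n * z ^ n)).
  - intros n; change (a n * z ^ n = @pow_n C_Ring z n * a n).
    transitivity (z ^ n * a n); [ring|].
    f_equal; symmetry; apply pow_n_Cpow.
  - apply (@is_series_decr_1 C_AbsRing C_NormedModule).
    change (is_cseries (fun n => a (S n) * z ^ S n) (l + - (a 0%nat * z ^ 0))).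
    rewrite H0; replace (l + - (0 * z ^ 0)) with l by ring; exact H.
Qed.

(** * Null sequences, and the series of the three basic functions *)

Lemma is_lim_seq_scal_zero (c : R) (u : nat -> R) :
  is_lim_seq u 0 -> is_lim_seq (fun n => c * u n)%R 0.
Proof.
  intros H; replace (Finite 0) with (Rbar_mult (Finite c) (Finite 0))
    by (simpl; f_equal; ring).
  apply is_lim_seq_scal_l; exact H.
Qed.

(* With [s = sqrt r], the factor [n s^n] stays bounded and [s^n] tends to 0. *)
Lemma is_lim_seq_INR_mult_pow (r : R) :
  (0 <= r < 1)%R -> is_lim_seq (fun n => INR n * r ^ n)%R 0.
Proof.
  intros Hr; set (s := sqrt r).
  assert (Hs0 : (0 <= s)%R) by apply sqrt_pos.
  assert (Hss : (s * s = r)%R) by (apply sqrt_sqrt; lra).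
  assert (Hs : (s < 1)%R) by nra.
  assert (Hp : forall n, (0 <= s ^ n <= 1)%R).
  { intros n; split; [apply pow_le; lra|].
    rewrite <- (pow1 n); apply pow_incr; lra. }
  (* Each of the [n] terms of [1 + s + ... + s^(n-1)] is at least [s^n], and this sum times [1 - s]
     is [1 - s^n]. *)
  assert (Hb : forall n, (INR n * s ^ n * (1 - s) <= 1 - s ^ n)%R).
  { induction n as [|n IH]; [simpl; lra|].
    rewrite S_INR; simpl; pose proof (Hp n).
    assert (s * (INR n * s ^ n * (1 - s)) <= s * (1 - s ^ n))%R
      by (apply Rmult_le_compat_l; lra).
    assert (s * s ^ n <= 1)%R by nra.
    nra. }
  apply (is_lim_seq_le_le (fun _ => 0%R) _ (fun n => / (1 - s) * s ^ n)%R).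
  - intros n; rewrite <- Hss, Rpow_mult_distr.
    pose proof (Hp n); pose proof (pos_INR n); pose proof (Hb n).
    split; [repeat apply Rmult_le_pos; lra|].
    rewrite <- Rmult_assoc; apply Rmult_le_compat_r; [lra|].
    apply (Rmult_le_reg_r (1 - s)); [lra|].
    rewrite Rinv_l; lra.
  - apply is_lim_seq_const.
  - apply is_lim_seq_scal_zero, is_lim_seq_geom; rewrite Rabs_right; lra.
Qed.

Lemma is_lim_seq_pow_S (r : R) :
  (0 <= r < 1)%R -> is_lim_seq (fun n => r ^ S n)%R 0.
Proof.
  intros Hr; apply (is_lim_seq_incr_1 (fun n => r ^ n)%R).
  apply is_lim_seq_geom; rewrite Rabs_right; lra.
Qed.

Lemma Cmod_inv_one_minus_le (z : C) :
  disk z -> (Cmod (/ (1 - z)) <= / (1 - Cmod z))%R.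
Proof.
  intros Hz; rewrite Cmod_inv by (apply disk_sub_neq0, Hz).
  unfold disk in Hz.
  apply Rinv_le_contravar; [lra|apply Cmod_one_minus_ge].
Qed.

Lemma is_cseries_geom_S (z : C) :
  disk z -> is_cseries (fun n => z ^ S n) (z / (1 - z)).
Proof.
  intros Hz; pose proof (disk_sub_neq0 z Hz) as H1.
  apply (is_cseries_of_partial_sums _ (fun n => z * (1 - z ^ S n) / (1 - z)) _
           (fun n => / (1 - Cmod z) * Cmod z ^ S (S n))%R).
  - simpl; field; exact H1.
  - intros n; rewrite !Cpow_S; field; exact H1.
  - intros n.
    replace (z * (1 - z ^ S n) / (1 - z) - z / (1 - z))
      with (- (/ (1 - z) * z ^ S (S n)))
      by (rewrite !Cpow_S; field; exact H1).
    rewrite Cmod_opp, Cmod_mult, Cmod_pow.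
    apply Rmult_le_compat_r; [apply pow_le, Cmod_ge_0|].
    apply Cmod_inv_one_minus_le, Hz.
  - apply is_lim_seq_scal_zero.
    apply (is_lim_seq_incr_1 (fun n => Cmod z ^ S n)%R).
    apply is_lim_seq_pow_S; split; [apply Cmod_ge_0|exact Hz].
Qed.

(** The partial sum up to exponent [n + 1] has the closed form obtained by differentiating a finite
    geometric sum. Its error is [((n + 1) z - (n + 2)) z^(n+2) / (1 - z)^2], whose first factor is
    at most [2 (n + 2)]. *)
Lemma is_cseries_koebe (z : C) :
  disk z -> is_cseries (fun n => INR (S n) * z ^ S n) (z / (1 - z) ^ 2).
Proof.
  intros Hz; pose proof (disk_sub_neq0 z Hz) as H1.
  apply (is_cseries_of_partial_sums _
    (fun n => z * (1 - INR (S (S n)) * z ^ S n + INR (S n) * z ^ S (S n))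
              / (1 - z) ^ 2) _
    (fun n => 2 * / (1 - Cmod z) ^ 2 * (INR (S (S n)) * Cmod z ^ S (S n)))%R).
  - simpl; rewrite RtoC_plus; field; exact H1.
  - intros n; rewrite !Cpow_S, !S_INR, !RtoC_plus; field; exact H1.
  - intros n.
    replace (z * (1 - INR (S (S n)) * z ^ S n + INR (S n) * z ^ S (S n))
             / (1 - z) ^ 2 - z / (1 - z) ^ 2)
      with ((INR (S n) * z - INR (S (S n))) * z ^ S (S n) * (/ (1 - z)) ^ 2)
      by (rewrite !Cpow_S, !S_INR, !RtoC_plus; field; exact H1).
    rewrite !Cmod_mult, !Cmod_pow, <- pow_inv.
    pose proof (Cmod_ge_0 z) as Hz0; pose proof (Cmod_ge_0 (/ (1 - z))) as Hi.
    pose proof (Cmod_inv_one_minus_le z Hz) as Hle.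
    assert (Hc : (Cmod (INR (S n) * z - INR (S (S n))) <= 2 * INR (S (S n)))%R).
    { eapply Rle_trans; [apply Cmod_triangle|].
      rewrite Cmod_opp, Cmod_mult, !Cmod_R, !Rabs_right
        by (apply Rle_ge, pos_INR).
      unfold disk in Hz; rewrite (S_INR (S n)).
      pose proof (pos_INR (S n)); nra. }
    assert (H2 : (Cmod (/ (1 - z)) ^ 2 <= (/ (1 - Cmod z)) ^ 2)%R)
      by (apply pow_incr; lra).
    assert (Hp : (0 <= Cmod z ^ S (S n))%R) by (apply pow_le; exact Hz0).
    apply Rle_trans with
      (2 * INR (S (S n)) * Cmod z ^ S (S n) * (/ (1 - Cmod z)) ^ 2)%R.
    + apply Rmult_le_compat;
        [apply Rmult_le_pos; [apply Cmod_ge_0|exact Hp]|apply pow_le, Hi| |exact H2].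
      apply Rmult_le_compat_r; assumption.
    + right; ring.
  - apply is_lim_seq_scal_zero.
    apply (is_lim_seq_ext (fun n => INR (n + 2) * Cmod z ^ (n + 2))%R).
    + intros n; replace (n + 2)%nat with (S (S n)) by lia; reflexivity.
    + apply (is_lim_seq_incr_n (fun n => INR n * Cmod z ^ n)%R 2).
      apply is_lim_seq_INR_mult_pow; split; [apply Cmod_ge_0|exact Hz].
Qed.

(** Taylor polynomial of degree at most [n + 1] of [log (1 - z) - log (1 - k z)], recursive in [n]
    so that it can be differentiated by induction. *)
Fixpoint log_poly (k : R) (n : nat) (z : C) : C :=
  ((k ^ S n - 1) / INR (S n))%R * z ^ S n
  + match n with O => 0 | S m => log_poly k m z end.

Lemma log_poly_S (k : R) (n : nat) (z : C) :
  log_poly k (S n) z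
  = ((k ^ S (S n) - 1) / INR (S (S n)))%R * z ^ S (S n) + log_poly k n z.
Proof. reflexivity. Qed.

(** The terms differentiate to [(k^(m+1) - 1) z^m], which split into two finite geometric sums, with
    ratios [k z] and [z]. *)
Lemma is_cderive_log_poly (k : R) (n : nat) (z : C) :
  (0 <= k < 1)%R -> disk z ->
  is_cderive (log_poly k n) z
    (k * (1 - (k * z) ^ S n) / (1 - k * z) - (1 - z ^ S n) / (1 - z)).
Proof.
  intros Hk Hz.
  pose proof (disk_sub_neq0 z Hz) as H1.
  pose proof (disk_sub_neq0 _ (disk_scal k z Hk Hz)) as H2.
  assert (Hterm : forall m,
    is_cderive (fun w => ((k ^ S m - 1) / INR (S m))%R * w ^ S m) z
      ((k ^ S m - 1) * z ^ m)).
  { intros m; eapply is_cderive_eq.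
    - apply is_cderive_scal, is_cderive_pow.
    - rewrite <- RtoC_pow, <- RtoC_minus, Cmult_assoc, <- RtoC_mult.
      f_equal; f_equal; field; apply not_0_INR; lia. }
  induction n as [|n IH]; simpl log_poly.
  - eapply is_cderive_eq.
    + apply is_cderive_plus; [apply (Hterm 0%nat)|apply is_cderive_const].
    + simpl; field; auto.
  - eapply is_cderive_eq.
    + apply is_cderive_plus; [apply (Hterm (S n))|apply IH].
    + rewrite !Cpow_mult_l, !Cpow_S; field; auto.
Qed.

(* The remainder of the series has derivative
   [k (k z)^(n+1) / (1 - k z) - z^(n+1) / (1 - z)], which is small along the
   whole segment from 0 to z. *)
Lemma is_cseries_log_branch (k : R) (L : C -> C) (z : C) :
  (0 <= k < 1)%R -> log_branch k L -> disk z ->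
  is_cseries (fun n => ((k ^ S n - 1) / INR (S n))%R * z ^ S n) (L z).
Proof.
  intros Hk HL Hz.
  set (r := Cmod z).
  assert (Hr : (0 <= r < 1)%R) by (split; [apply Cmod_ge_0|exact Hz]).
  (* The constant 4 is the factor 2 of the ray estimate times the two tails, each at most
     [r^(n+1) / (1 - r)] for [|w| <= r]. *)
  apply (is_cseries_of_partial_sums _ (fun n => log_poly k n z) _
           (fun n => 4 * r * / (1 - r) * r ^ S n)%R).
  - simpl; ring.
  - intros n; rewrite log_poly_S; ring.
  - intros n.
    assert (H0 : log_poly k n 0 - L 0 = 0).
    { rewrite (proj1 (proj2 HL)).
      induction n as [|n IH].
      - simpl; ring.
      - rewrite log_poly_S, Cpow_S.
        replace (log_poly k n 0) with (log_poly k n 0 - 0) by ring.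
        rewrite IH; ring. }
    assert (H : (Cmod ((log_poly k n z - L z) - (log_poly k n 0 - L 0))
                 <= 2 * ((2 * (/ (1 - r) * r ^ S n)) * Cmod z))%R).
    { apply (Cmod_ray_increment_le (fun w => log_poly k n w - L w)
        (fun w => / (1 - w) * w ^ S n - k * (/ (1 - k * w) * (k * w) ^ S n)));
        [exact Hz| |].
      - intros w Hw.
        pose proof (disk_sub_neq0 w Hw) as H1.
        pose proof (disk_sub_neq0 _ (disk_scal k w Hk Hw)) as H2.
        eapply is_cderive_eq.
        + apply is_cderive_minus;
            [apply is_cderive_log_poly; assumption
            |exact (log_branch_derive k L w Hk HL Hw)].
        + field; auto.
      - assert (Hbound : forall w : C, (Cmod w <= r)%R ->
          (Cmod (/ (1 - w) * w ^ S n) <= / (1 - r) * r ^ S n)%R).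
        { intros w Hw; rewrite Cmod_mult, Cmod_pow.
          pose proof (Cmod_ge_0 w).
          apply Rmult_le_compat;
            [apply Cmod_ge_0|apply pow_le; assumption| |apply pow_incr; lra].
          eapply Rle_trans; [apply Cmod_inv_one_minus_le; unfold disk; lra|].
          apply Rinv_le_contravar; lra. }
        intros w Hw; fold r in Hw.
        assert (Hkw : (Cmod (k * w) <= r)%R).
        { rewrite Cmod_mult, Cmod_R, Rabs_right by lra.
          pose proof (Cmod_ge_0 w); nra. }
        pose proof (Hbound w Hw); pose proof (Hbound _ Hkw).
        eapply Rle_trans; [apply Cmod_triangle|].
        rewrite Cmod_opp, (Cmod_mult k), Cmod_R, (Rabs_right k) by lra.
        pose proof (Cmod_ge_0 (/ (1 - k * w) * (k * w) ^ S n)); nra. }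
    rewrite H0 in H; fold r in H.
    replace (log_poly k n z - L z - 0) with (log_poly k n z - L z) in H by ring.
    eapply Rle_trans; [exact H|right; ring].
  - apply is_lim_seq_scal_zero, is_lim_seq_pow_S; exact Hr.
Qed.

Lemma RtoC_neq0 (x : R) : x <> 0%R -> RtoC x <> 0.
Proof. intros Hx E; apply Hx; injection E; auto. Qed.

(** * Taylor coefficients of the two analytic parts *)

(** [A n k] splits as [n / (1 - k) - 2 k / (1 - k)^2 - k (1 + k) / (1 - k)^3 * (k^n - 1) / n], one
    summand for each term of [shear_h]. *)
Lemma is_cseries_shear_h (k : R) (L : C -> C) (z : C) :
  (0 <= k < 1)%R -> log_branch k L -> disk z ->
  is_cseries (fun n => A (S n) k * z ^ S n) (shear_h k L z).
Proof.
  intros Hk HL Hz.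
  pose proof (disk_sub_neq0 z Hz) as H1.
  pose proof (disk_sub_neq0 _ (disk_RtoC k Hk)) as H3.
  replace (shear_h k L z) with
    ((1 / (1 - k))%R * (z / (1 - z) ^ 2)
     + ((- (2 * k / (1 - k) ^ 2))%R * (z / (1 - z))
        + (- (k * (1 + k) / (1 - k) ^ 3))%R * L z)).
  - eapply is_cseries_ext; cycle 1.
    + apply is_cseries_plus; [|apply is_cseries_plus]; apply is_cseries_scal;
        [apply is_cseries_koebe|apply is_cseries_geom_S
        |apply is_cseries_log_branch]; eassumption.
    + intros n; cbv beta.
      assert (Hn : INR (S n) <> 0%R) by (apply not_0_INR; lia).
      rewrite !Cmult_assoc, <- !RtoC_mult, <- !Cmult_plus_distr_r, <- !RtoC_plus.
      f_equal; f_equal; unfold A; field; split; [exact Hn|lra].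
  - unfold shear_h.
    rewrite ?RtoC_opp, ?RtoC_div by first [lra | apply pow_nonzero; lra].
    rewrite ?RtoC_mult, ?RtoC_pow, ?RtoC_plus, ?RtoC_minus.
    field; auto.
Qed.

Lemma is_cseries_shear_g (k : R) (L : C -> C) (z : C) :
  (0 <= k < 1)%R -> log_branch k L -> disk z ->
  is_cseries (fun n => B (S n) k * z ^ S n) (shear_g k L z).
Proof.
  intros Hk HL Hz.
  pose proof (disk_sub_neq0 z Hz) as H1.
  pose proof (disk_sub_neq0 _ (disk_RtoC k Hk)) as H3.
  replace (shear_g k L z) with
    ((k / (1 - k))%R * (z / (1 - z) ^ 2)
     + ((- (2 * k / (1 - k) ^ 2))%R * (z / (1 - z))
        + (- (k * (1 + k) / (1 - k) ^ 3))%R * L z)).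
  - eapply is_cseries_ext; cycle 1.
    + apply is_cseries_plus; [|apply is_cseries_plus]; apply is_cseries_scal;
        [apply is_cseries_koebe|apply is_cseries_geom_S
        |apply is_cseries_log_branch]; eassumption.
    + intros n; cbv beta.
      assert (Hn : INR (S n) <> 0%R) by (apply not_0_INR; lia).
      rewrite !Cmult_assoc, <- !RtoC_mult, <- !Cmult_plus_distr_r, <- !RtoC_plus.
      f_equal; f_equal; unfold B; field; split; [exact Hn|lra].
  - unfold shear_g.
    rewrite ?RtoC_opp, ?RtoC_div by first [lra | apply pow_nonzero; lra].
    rewrite ?RtoC_mult, ?RtoC_pow, ?RtoC_plus, ?RtoC_minus.
    field; auto.
Qed.

(** The numerator vanishes at [n = 0] because [k^0 = 1], so the value is 0 whatever the inverse of 0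
    is. *)
Lemma A_0 (k : R) : A 0 k = 0%R.
Proof. unfold A; simpl; unfold Rdiv; ring. Qed.

Lemma A_1 (k : R) : (0 <= k < 1)%R -> A 1 k = 1%R.
Proof. intros Hk; unfold A; simpl; field; lra. Qed.

Lemma B_0 (k : R) : B 0 k = 0%R.
Proof. unfold B; simpl; unfold Rdiv; ring. Qed.

Lemma B_1 (k : R) : (0 <= k < 1)%R -> B 1 k = 0%R.
Proof. intros Hk; unfold B; simpl; field; lra. Qed.

Lemma Cconj_RtoC (x : R) : Cconj x = x.
Proof. unfold Cconj, RtoC; simpl; f_equal; ring. Qed.

(** * Univalence in the half-plane coordinate *)

(** The real part is [(1 - |w|^2) / |1 - w|^2]. With [w = z] this places [s] in the right
    half-plane; with [w = k z] it gives the sign of the derivative along level lines. *)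
Lemma Re_cayley_pos (w : C) : disk w -> (0 < Re ((1 + w) / (1 - w)))%R.
Proof.
  intros Hw; pose proof (disk_sub_neq0 w Hw) as H1.
  assert (H2 : (Re w ^ 2 + Im w ^ 2 < 1)%R).
  { unfold disk in Hw; rewrite <- Cmod2_alt.
    pose proof (Cmod_ge_0 w); nra. }
  assert (H3 : (0 < (1 - Re w) ^ 2 + Im w ^ 2)%R).
  { replace ((1 - Re w) ^ 2 + Im w ^ 2)%R with (Cmod (1 - w) ^ 2)%R.
    - apply pow_lt, Cmod_gt_0, H1.
    - rewrite Cmod2_alt; destruct w as [a b]; simpl; ring. }
  replace (Re ((1 + w) / (1 - w)))
    with ((1 - (Re w ^ 2 + Im w ^ 2)) / ((1 - Re w) ^ 2 + Im w ^ 2))%R.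
  - apply Rdiv_lt_0_compat; lra.
  - destruct w as [a b]; simpl in *; field; nra.
Qed.

(** [|s + 1|^2 - |s - 1|^2 = 4 Re s]. *)
Lemma disk_cayley (s : C) : (0 < Re s)%R -> disk ((s - 1) / (s + 1)).
Proof.
  intros Hs; unfold disk.
  assert (H1 : (0 < Cmod (s + 1))%R).
  { eapply Rlt_le_trans; [|apply re_le_Cmod].
    eapply Rlt_le_trans; [|apply Rle_abs].
    destruct s as [a b]; simpl in *; lra. }
  rewrite Cmod_div by (apply (proj2 (Cmod_gt_0 _)), H1).
  apply (Rmult_lt_reg_r (Cmod (s + 1))); [exact H1|].
  unfold Rdiv; rewrite Rmult_assoc, Rinv_l, Rmult_1_r, Rmult_1_l by lra.
  apply Rsqr_incrst_0; [|apply Cmod_ge_0|lra].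
  rewrite !Rsqr_pow2, !Cmod2_alt; destruct s as [a b]; simpl in *; nra.
Qed.

Lemma cayley_inv (z : C) : 1 - z <> 0 ->
  ((1 + z) / (1 - z) - 1) / ((1 + z) / (1 - z) + 1) = z.
Proof.
  intros Hz.
  assert (H2 : RtoC 2 <> 0) by (apply RtoC_neq0; lra).
  replace ((1 + z) / (1 - z) - 1) with (2 * z / (1 - z)) by (field; exact Hz).
  replace ((1 + z) / (1 - z) + 1) with (2 / (1 - z)) by (field; exact Hz).
  field; auto.
Qed.

Lemma eq_of_pos_derive (phi dphi : R -> R) (p q : R) :
  (forall t, (0 < t)%R -> is_derive phi t (dphi t)) ->
  (forall t, (0 < t)%R -> (0 < dphi t)%R) ->
  (0 < p)%R -> (0 < q)%R -> phi p = phi q -> p = q.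
Proof.
  intros Hd Hpos Hp Hq E.
  assert (Hmin : (0 < Rmin p q)%R) by (apply Rmin_pos; assumption).
  destruct (MVT_gen phi p q dphi) as [c [Hc Ec]].
  - intros t Ht; apply Hd; lra.
  - intros t Ht; apply continuity_pt_filterlim.
    apply (ex_derive_continuous phi); eexists; apply Hd; lra.
  - pose proof (Hpos c ltac:(lra)).
    rewrite E in Ec; nra.
Qed.

(* [s = p + i c / p] runs over the points of the right half-plane with
   [Re s * Im s = c], i.e. over a level line of the imaginary part of the Koebe
   function [(s^2 - 1) / 4]. *)
Lemma is_derive_shear_level_line (k : R) (h g : C -> C) (c p : R) :
  (0 <= k < 1)%R -> koebe_shear k h g -> (0 < p)%R ->
  let s : C := (p, (c / p)%R) in
  let z := (s - 1) / (s + 1) in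
  is_derive (fun t : R =>
      Re (h ((((t, (c / t)%R) : C) - 1) / (((t, (c / t)%R) : C) + 1))
          + g ((((t, (c / t)%R) : C) - 1) / (((t, (c / t)%R) : C) + 1)))) p
    ((p + c ^ 2 / p ^ 3) / 2 * Re ((1 + k * z) / (1 - k * z)))%R.
Proof.
  intros Hk H Hp s z.
  assert (Hz : disk z) by (apply disk_cayley; exact Hp).
  assert (Hs : s + 1 <> 0).
  { intros E; apply (f_equal Re) in E; simpl in E; lra. }
  assert (H2 : RtoC 2 <> 0) by (apply RtoC_neq0; lra).
  destruct (koebe_shear_derive k h g z Hk H Hz) as [Hh Hg].
  assert (HM : is_cderive (fun w => (w - 1) / (w + 1)) s (2 / (s + 1) ^ 2)).
  { eapply is_cderive_eq; [cderive; exact Hs|field; exact Hs]. }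
  pose proof (is_cderive_plus _ _ _ _ _
    (is_cderive_comp h _ s _ _ Hh HM) (is_cderive_comp g _ s _ _ Hg HM)) as HG.
  destruct (is_cderive_curve _ (fun t => t) (fun t => (c / t)%R) p 1
    (- (c / p ^ 2))%R _ HG) as [HD _].
  { auto_derive; [exact I|reflexivity]. }
  { auto_derive; [lra|field; lra]. }
  cbv beta in HD.
  match type of HD with is_derive _ _ ?x =>
    replace ((p + c ^ 2 / p ^ 3) / 2 * Re ((1 + k * z) / (1 - k * z)))%R
      with x; [exact HD|] end.
  pose proof (disk_sub_neq0 _ (disk_scal k z Hk Hz)) as Hkz.
  assert (E1 : 1 + z = 2 * s / (s + 1)) by (unfold z; field; exact Hs).
  assert (E2 : 1 - z = 2 / (s + 1)) by (unfold z; field; exact Hs).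
  transitivity (Re (((p + c ^ 2 / p ^ 3) / 2)%R * ((1 + k * z) / (1 - k * z)))).
  - f_equal.
    (* The velocity of the curve is [1 - i c / p^2]. Its product with [s] has imaginary part
       [c / p - c / p = 0], so this factor is real and leaves the real part. *)
    assert (E3 : RtoC ((p + c ^ 2 / p ^ 3) / 2)
                 = s * ((1, - (c / p ^ 2))%R : C) / 2).
    { unfold s; apply injective_projections; simpl; field; lra. }
    (* In terms of [s] one has [h' = s (s + 1)^2 / (4 (1 - k z))], and [dz/ds = 2 / (s + 1)^2]
       cancels the square. *)
    rewrite E3; unfold shear_dh; rewrite E1, E2.
    field; repeat split; assumption.
  - destruct ((1 + k * z) / (1 - k * z)) as [a b]; simpl; ring.
Qed.

Lemma koebe_shear_univalent (k : R) (h g : C -> C) :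
  (0 <= k < 1)%R -> koebe_shear k h g ->
  univalent (fun z => h z + Cconj (g z)).
Proof.
  intros Hk H z1 z2 Hz1 Hz2 E.
  pose proof (disk_sub_neq0 z1 Hz1) as N1.
  pose proof (disk_sub_neq0 z2 Hz2) as N2.
  pose proof (Re_cayley_pos z1 Hz1) as P1.
  pose proof (Re_cayley_pos z2 Hz2) as P2.
  rewrite <- (cayley_inv z1 N1) in E |- *; rewrite <- (cayley_inv z2 N2) in E |- *.
  assert (EF : forall z, disk z -> 1 - z <> 0 ->
    Im (h z - g z)
    = (Re ((1 + z) / (1 - z)) * Im ((1 + z) / (1 - z)) / 2)%R).
  { intros z Hz Hn.
    assert (H4 : RtoC 4 <> 0) by (apply RtoC_neq0; lra).
    destruct H as [_ [_ [_ [_ H]]]]; rewrite (proj1 (H z Hz)).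
    replace (z / (1 - z) ^ 2)
      with ((((1 + z) / (1 - z)) * ((1 + z) / (1 - z)) - 1) * (/ 4)%R)
      by (rewrite RtoC_inv by lra; field; auto).
    destruct ((1 + z) / (1 - z)) as [a b]; simpl; field. }
  pose proof (EF z1 Hz1 N1) as F1; pose proof (EF z2 Hz2 N2) as F2.
  (* Only the arguments of [h] and [g] are rewritten; the quotients on the right stay visible so
     that they can be split into [p1 + i q1] and [p2 + i q2]. *)
  rewrite <- (cayley_inv z1 N1) in F1 at 1 2.
  rewrite <- (cayley_inv z2 N2) in F2 at 1 2.
  destruct ((1 + z1) / (1 - z1)) as [p1 q1].
  destruct ((1 + z2) / (1 - z2)) as [p2 q2].
  simpl Re in *; simpl Im in F1, F2.
  assert (Ec : (p1 * q1 = p2 * q2)%R).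
  { apply (f_equal Im) in E; simpl in E, F1, F2; unfold Im in *; lra. }
  assert (Q1 : q1 = (p1 * q1 / p1)%R) by (field; lra).
  assert (Q2 : q2 = (p1 * q1 / p2)%R) by (rewrite Ec; field; lra).
  assert (Ep : p1 = p2).
  { eapply (eq_of_pos_derive _ _ p1 p2);
      [intros t Ht; apply (is_derive_shear_level_line k h g (p1 * q1) t Hk H Ht)
      | | exact P1 | exact P2 |].
    - intros t Ht; cbv beta zeta; apply Rmult_lt_0_compat.
      + pose proof (pow_lt t 3 Ht).
        assert (0 <= (p1 * q1) ^ 2 / t ^ 3)%R
          by (apply Rdiv_le_0_compat; [apply pow2_ge_0|assumption]).
        lra.
      + apply Re_cayley_pos, disk_scal, disk_cayley; assumption.
    - cbv beta; rewrite <- Q1, <- Q2.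
      apply (f_equal Re) in E; exact E. }
  subst p2; rewrite Q1, Q2; reflexivity.
Qed.

(** * Partial derivatives and Jacobian of a harmonic function *)

(** The chain rule along the horizontal and vertical lines through [z], with velocities 1 and [i];
    conjugation turns [i b] into [- i Cconj b]. *)
Lemma partials_harmonic (h g : C -> C) (z a b : C) :
  is_cderive h z a -> is_cderive g z b ->
  partial_x (fun w => h w + Cconj (g w)) z = a + Cconj b /\
  partial_y (fun w => h w + Cconj (g w)) z = Ci * (a - Cconj b).
Proof.
  intros Hh Hg.
  replace z with (Re z, Im z) in Hh, Hg by (destruct z; reflexivity).
  assert (Hx : is_derive (fun t : R => t) (Re z) 1%R)
    by (auto_derive; [exact I|reflexivity]).
  assert (Hx0 : is_derive (fun _ : R => Im z) (Re z) 0%R)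
    by (auto_derive; [exact I|reflexivity]).
  assert (Hy : is_derive (fun t : R => t) (Im z) 1%R)
    by (auto_derive; [exact I|reflexivity]).
  assert (Hy0 : is_derive (fun _ : R => Re z) (Im z) 0%R)
    by (auto_derive; [exact I|reflexivity]).
  destruct (is_cderive_curve h (fun t => t) (fun _ => Im z) _ _ _ _ Hh Hx Hx0)
    as [H1 H2].
  destruct (is_cderive_curve g (fun t => t) (fun _ => Im z) _ _ _ _ Hg Hx Hx0)
    as [G1 G2].
  destruct (is_cderive_curve h (fun _ => Re z) (fun t => t) _ _ _ _ Hh Hy0 Hy)
    as [H3 H4].
  destruct (is_cderive_curve g (fun _ => Re z) (fun t => t) _ _ _ _ Hg Hy0 Hy)
    as [G3 G4].
  split; apply injective_projections; unfold partial_x, partial_y; simpl fst;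
    simpl snd.
  - transitivity (Re (a * (1, 0)%R) + Re (b * (1, 0)%R))%R.
    + apply is_derive_unique; exact (is_derive_plus _ _ _ _ _ H1 G1).
    + destruct a, b; simpl; ring.
  - transitivity (Im (a * (1, 0)%R) - Im (b * (1, 0)%R))%R.
    + apply is_derive_unique; exact (is_derive_minus _ _ _ _ _ H2 G2).
    + destruct a, b; simpl; ring.
  - transitivity (Re (a * (0, 1)%R) + Re (b * (0, 1)%R))%R.
    + apply is_derive_unique; exact (is_derive_plus _ _ _ _ _ H3 G3).
    + destruct a, b; simpl; ring.
  - transitivity (Im (a * (0, 1)%R) - Im (b * (0, 1)%R))%R.
    + apply is_derive_unique; exact (is_derive_minus _ _ _ _ _ H4 G4).
    + destruct a, b; simpl; ring.
Qed.

Lemma d_zbar_harmonic (h g : C -> C) (z a b : C) :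
  is_cderive h z a -> is_cderive g z b ->
  d_zbar (fun w => h w + Cconj (g w)) z = Cconj b.
Proof.
  intros Hh Hg; destruct (partials_harmonic h g z a b Hh Hg) as [Ex Ey].
  unfold d_zbar; rewrite Ex, Ey.
  assert (H2 : RtoC 2 <> 0) by (apply RtoC_neq0; lra).
  replace (a + Cconj b + Ci * (Ci * (a - Cconj b)))
    with (a + Cconj b + (Ci * Ci) * (a - Cconj b)) by ring.
  replace (Ci * Ci) with (RtoC (-1))
    by (apply injective_projections; simpl; ring).
  field; exact H2.
Qed.

Lemma jacobian_harmonic (h g : C -> C) (z a b : C) :
  is_cderive h z a -> is_cderive g z b ->
  jacobian (fun w => h w + Cconj (g w)) z = (Cmod a ^ 2 - Cmod b ^ 2)%R.
Proof.
  intros Hh Hg; destruct (partials_harmonic h g z a b Hh Hg) as [Ex Ey].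
  unfold jacobian; rewrite Ex, Ey, !Cmod2_alt.
  destruct a, b; simpl; ring.
Qed.

(** The Jacobian is [|h'|^2 - |g'|^2], and [|g'| = |k z| |h'| < |h'|] strictly because [h'] has no
    zero. *)
Lemma koebe_shear_sense_preserving (k : R) (h g : C -> C) :
  (0 <= k < 1)%R -> koebe_shear k h g ->
  sense_preserving (fun z => h z + Cconj (g z)).
Proof.
  intros Hk H z Hz.
  destruct (koebe_shear_derive k h g z Hk H Hz) as [Hh Hg].
  rewrite (jacobian_harmonic h g z _ _ Hh Hg), Cmod_mult.
  pose proof (proj1 (Cmod_gt_0 _) (shear_dh_neq0 k z Hk Hz)) as Hm.
  pose proof (disk_scal k z Hk Hz) as Hd; unfold disk in Hd.
  pose proof (Cmod_ge_0 (k * z)).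
  assert (Cmod (k * z) * Cmod (shear_dh k z) < Cmod (shear_dh k z))%R by nra.
  assert (0 <= Cmod (k * z) * Cmod (shear_dh k z))%R by nra.
  nra.
Qed.

Theorem mainTheorem4 (k K : R) (hk : (0 <= k < 1)%R)
    (hK : K = ((1 + k) / (1 - k))%R) :
  (exists h0 g0 : C -> C, koebe_shear k h0 g0 /\
     forall h g : C -> C, koebe_shear k h g ->
       forall z : C, disk z -> h z = h0 z /\ g z = g0 z) /\
  (exists L0 : C -> C, log_branch k L0 /\
     forall L : C -> C, log_branch k L -> forall z : C, disk z -> L z = L0 z) /\
  forall h g L : C -> C, koebe_shear k h g -> log_branch k L ->
    let f := fun z : C => h z + Cconj (g z) in
    S_HK0 K f /\
    (forall z : C, disk z ->
       f z =
         1 / (k - 1) ^ 3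
           * ((k - 1) * (1 - 3 * k + 2 * k * z) * z / (1 - z) ^ 2
              + k * (k + 1) * L z)
         + k / (k - 1) ^ 3
           * Cconj ((1 - k) * (1 + k - 2 * z) * z / (1 - z) ^ 2
                    + (k + 1) * L z)) /\
    (forall z : C, disk z ->
       exists SA SB : C,
         @is_series C_AbsRing C_NormedModule
           (fun n : nat => A (n + 2) k * z ^ (n + 2)) SA /\
         @is_series C_AbsRing C_NormedModule
           (fun n : nat => B (n + 2) k * Cconj z ^ (n + 2)) SB /\
         f z = z + SA + SB).
Proof.
  split; [|split].
  - pose proof (koebe_shear_of_log k _ hk (log_branch_Clog k hk)) as H0.
    eexists; eexists; split; [exact H0|].
    intros h g H; exact (koebe_shear_unique k _ _ _ _ hk H H0).
  - eexists; split; [exact (log_branch_Clog k hk)|].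
    intros L HL; exact (log_branch_unique k _ _ hk HL (log_branch_Clog k hk)).
  - intros h g L H HL f.
    (* The comparison solution is built from the given [L], so that [h] and [g] are expressed
       through the very function in the claimed formula. *)
    pose proof (koebe_shear_unique k _ _ _ _ hk H (koebe_shear_of_log k L hk HL))
      as Ehg.
    assert (Hsh : forall z, disk z ->
      is_cseries (fun n => A (S n) k * z ^ S n) (h z)).
    { intros z Hz; rewrite (proj1 (Ehg z Hz)).
      apply is_cseries_shear_h; assumption. }
    assert (Hsg : forall z, disk z ->
      is_cseries (fun n => B (S n) k * z ^ S n) (g z)).
    { intros z Hz; rewrite (proj2 (Ehg z Hz)).
      apply is_cseries_shear_g; assumption. }
    assert (Hcan : canonical_form f h g (fun n => A n k) (fun n => B n k)).
    { split; [apply H|]; split; [apply H|]; split; [reflexivity|].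
      rewrite A_0, A_1, B_0 by exact hk.
      repeat (split; [reflexivity|]); split.
      - intros z Hz; apply is_pseries_of_shifted;
          [rewrite A_0; reflexivity|apply Hsh, Hz].
      - intros z Hz; apply is_pseries_of_shifted;
          [rewrite B_0; reflexivity|apply Hsg, Hz]. }
    split; [|split].
    + split; [split; [split; [|split]|]|].
      * exists h, g, (fun n => RtoC (A n k)), (fun n => RtoC (B n k)); exact Hcan.
      * exact (koebe_shear_univalent k h g hk H).
      * exact (koebe_shear_sense_preserving k h g hk H).
      * exists h, g, (fun n => RtoC (A n k)), (fun n => RtoC (B n k)).
        split; [exact Hcan|]; intros z Hz.
        destruct H as [_ [_ [_ [_ H]]]].
        destruct (H z Hz) as [_ [_ Hq]]; rewrite Hq.
        rewrite Cmod_mult, Cmod_R, Rabs_right by lra.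
        (* The bound on the dilatation thus reads [k |z| <= k]. *)
        replace ((K - 1) / (K + 1))%R with k by (rewrite hK; field; lra).
        unfold disk in Hz; nra.
      * destruct (koebe_shear_derive k h g 0 hk H disk_0) as [Hh Hg].
        unfold f; rewrite (d_zbar_harmonic h g 0 _ _ Hh Hg).
        replace (k * 0 * shear_dh k 0) with (RtoC 0) by ring.
        apply Cconj_RtoC.
    + intros z Hz; unfold f; rewrite (proj1 (Ehg z Hz)), (proj2 (Ehg z Hz)).
      pose proof (disk_sub_neq0 z Hz) as N1.
      pose proof (disk_sub_neq0 _ (disk_RtoC k hk)) as N2.
      assert (N3 : k - 1 <> 0)
        by (rewrite <- RtoC_minus; apply RtoC_neq0; lra).
      (* This factor is real, so it can be moved under the conjugation, where it meets [shear_g]. *)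
      assert (Ec : Cconj (k / (k - 1) ^ 3) = k / (k - 1) ^ 3).
      { rewrite <- RtoC_minus, <- RtoC_pow, <- RtoC_div by (apply pow_nonzero; lra).
        apply Cconj_RtoC. }
      rewrite <- Ec, <- Cmult_conj; f_equal.
      * unfold shear_h; field; auto.
      * f_equal; unfold shear_g; field; auto.
    + intros z Hz.
      (* The series for [h] and [g] start at exponent 1. Removing that term leaves exponents [n + 2]
         and subtracts [A 1 k * z = z] from one sum and [B 1 k] times the conjugate of [z], which is
         0, from the other. *)
      pose proof (is_cseries_shift _ _ (Hsh z Hz)) as SA.
      pose proof (is_cseries_shift _ _ (is_cseries_conj _ _ (Hsg z Hz))) as SB.
      cbv beta in SA, SB.
      eexists; eexists; split; [|split].
      * eapply is_cseries_ext; [|exact SA].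
        intros n; cbv beta; replace (n + 2)%nat with (S (S n)) by lia; reflexivity.
      * eapply is_cseries_ext; [|exact SB].
        intros n; cbv beta; replace (n + 2)%nat with (S (S n)) by lia.
        rewrite Cmult_conj, Cconj_RtoC, Cpow_conj; reflexivity.
      * rewrite A_1, B_1, Cmult_conj, Cconj_RtoC by exact hk.
        unfold f; simpl; ring.
Qed.
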